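(* For every $n\ge 3$, the Whitehouse complex $\Delta_n$ is homotopy equivalent to a wedge of $(n-2)!$ spheres of dimension $n-4$.
   Context: The Whitehouse complex $\Delta_n$ ($n\ge 3$) is the simplicial complex with vertex set $V_n=\{S\subseteq\{2,\dots,n\}: 2\le |S|\le n-2\}$, in which a subset $F\subseteq V_n$ is a face iff for all $S,T\in F$ one has $S\subseteq T$, $T\subseteq S$, or $S\cap T=\emptyset$. Convention: $\Delta_3=\{\emptyset\}$ is regarded as the $(-1)$-dimensional sphere (a wedge of one $(-1)$-sphere). *)

(* Defs.v *)
From HB Require Import structures.
From mathcomp Require Import all_boot all_order all_algebra.
From mathcomp Require Import all_classical all_reals all_analysis.

Set Implicit Arguments.
Unset Strict Implicit.
Unset Printing Implicit Defensive.

Import Order.TTheory GRing.Theory Num.Theory.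
Import numFieldNormedType.Exports.
Local Open Scope classical_set_scope.
Local Open Scope ring_scope.

Definition homotopic_to_id (R : realType) (X : topologicalType)
    (A : set X) (h : X -> X) : Prop :=
  exists H : (R * X)%type -> X,
    [/\ {within [set t : R | 0 <= t <= 1] `*` A, continuous H},
        (forall (t : R) a, 0 <= t <= 1 -> A a -> A (H (t, a))),
        (forall a, A a -> H (0%R, a) = a) &
        (forall a, A a -> H (1%R, a) = h a)].

Definition homotopy_equivalent (R : realType) (X Y : topologicalType)
    (A : set X) (B : set Y) : Prop :=
  exists (f : X -> Y) (g : Y -> X),
    [/\ (forall a, A a -> B (f a)) /\ (forall b, B b -> A (g b)),
        {within A, continuous f},
        {within B, continuous g},
        homotopic_to_id R A (g \o f) &
        homotopic_to_id R B (f \o g)].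

(* Geometric realization of a finite abstract simplicial complex K on a      *)
(* finite vertex type V (faces given as a predicate on {set V}), in          *)
(* barycentric coordinates inside R^V (product = Euclidean topology).         *)
(* The empty complex {∅} has empty realization.                              *)

Definition realization (R : realType) (V : finType) (K : pred {set V}) :
    set {ptws V -> R} :=
  [set x : {ptws V -> R} |
     (forall v, 0 <= x v) /\ (\sum_(v : V) x v = 1) /\
     K (finset (fun v : V => x v != 0))].

Definition wh_vertex (n : nat) (S : {set 'I_n.+1}) : bool :=
  [&& [forall i in S, 2 <= nat_of_ord i]%N, (2 <= #|S|)%N & (#|S| <= n - 2)%N].

Definition whitehouse_face (n : nat) (F : {set {set 'I_n.+1}}) : bool :=
  [forall S in F, wh_vertex S] &&
  [forall S in F, forall T in F,
     [|| S \subset T, T \subset S | [disjoint S & T]]].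

(* Wedge of m spheres of dimension d, for d >= 0, as a subspace of           *)
(* R^d x R^m: the j-th sphere is the round unit d-sphere centred at e_j in   *)
(* the (d+1)-plane R^d x R e_j; all of them pass through the origin and      *)
(* pairwise meet only there.  The origin is included (wedge of 0 spheres =   *)
(* a point).  For dimension -1 (k = 0 below) the space is empty, following    *)
(* the paper's convention that Δ_3 = {∅} is a wedge of one (-1)-sphere.       *)
(* Here k = d + 1 (so the sphere dimension is k - 1).                         *)

Definition wedge_of_spheres (R : realType) (m k : nat) :
    set {ptws ('I_k.-1 + 'I_m)%type -> R} :=
  if k is 0 then set0 else
  [set x : {ptws ('I_k.-1 + 'I_m)%type -> R} |
     (forall v, x v = 0) \/
     exists j : 'I_m,
       (forall j' : 'I_m, j' != j -> x (inr j') = 0) /\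
       \sum_(i < k.-1) (x (inl i)) ^+ 2 + (x (inr j) - 1) ^+ 2 = 1].

(* Main.v *)
Require Import Defs.
From HB Require Import structures.
From mathcomp Require Import all_boot all_order all_algebra perm.
From mathcomp Require Import all_classical all_reals all_analysis.
From mathcomp Require Import ring lra zify.
Import numFieldNormedType.Exports.

(** Fix the leaf a = 2 and call a vertex S marked when a is in S. The marked part C of a face is a chain
    {a} < S_1 < ... < S_r < {2,...,n}. If two consecutive members of this extended chain differ by at least two
    leaves, their difference T is an unmarked vertex that can be added to every face with marked part C, so the faces
    with marked part C form a cone; pushing mass from C to T removes these strata one by one, the largest C first, and
    contracts the subcomplex of all faces whose marked part has a gap. The remaining faces are the chains without gap:
    they are facets with n-3 vertices, and they correspond to the (n-2)! orderings of the leaves other than a.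
    Hence the complex is a contractible subcomplex with (n-2)! open simplices of dimension n-4 attached, and
    collapsing the subcomplex gives the wedge. *)

Set Implicit Arguments.
Unset Strict Implicit.
Unset Printing Implicit Defensive.

Import Order.TTheory GRing.Theory Num.Theory.
Local Open Scope classical_set_scope.
Local Open Scope ring_scope.

(** * Topological preliminaries *)

Lemma ptws_continuous (X : topologicalType) (I : Type) (T : topologicalType)
    (f : X -> {ptws I -> T}) :
  (forall i, continuous (fun x => f x i)) -> continuous f.
Proof.
move=> cf x; apply/cvg_sup => i U [V] [[W] oW <-] WfN WU.
by apply: (filterS WU); apply: cf; apply: open_nbhs_nbhs.
Qed.

Lemma continuous_compT (X Y Z : topologicalType) (f : X -> Y) (g : Y -> Z) :
  continuous f -> continuous g -> continuous (fun x => g (f x)).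
Proof. by move=> cf cg x; apply: (continuous_comp (cf x) (cg _)). Qed.

Lemma continuous_pair (X Y Z : topologicalType) (f : X -> Y) (g : X -> Z) :
  continuous f -> continuous g -> continuous (fun x => (f x, g x)).
Proof. by move=> cf cg x; apply: cvg_pair; [exact: cf | exact: cg]. Qed.

Lemma eval_continuous (I : eqType) (T : topologicalType) (i : I) :
  continuous (fun x : {ptws I -> T} => x i).
Proof. exact: (@proj_continuous I (fun=> T) i). Qed.

Lemma hausdorff_ptws (I : eqType) (T : topologicalType) :
  hausdorff_space T -> hausdorff_space {ptws I -> T}.
Proof. by move=> hT; apply: (@hausdorff_product I (fun=> T)). Qed.

Lemma continuous_bigmin (R : realType) (X : topologicalType) (I : Type)
    (r : seq I) (P : pred I) (f : I -> X -> R) (c : R) :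
  (forall i, continuous (f i)) ->
  continuous (fun x => \big[Num.min/c]_(i <- r | P i) f i x).
Proof.
move=> cf x; apply: cvg_big => [|i _]; last exact: cf.
move=> y; apply: (@continuous_min R _ fst snd).
  exact: cvg_fst.
exact: cvg_snd.
Qed.

Lemma continuous_bigsum (R : realType) (X : topologicalType) (I : Type)
    (r : seq I) (P : pred I) (f : I -> X -> R) :
  (forall i, continuous (f i)) ->
  continuous (fun x => \sum_(i <- r | P i) f i x).
Proof.
move=> cf x; apply: cvg_big => [|i _]; last exact: cf.
exact: add_continuous.
Qed.

(** A continuous map from a compact space to a Hausdorff space is closed: within the image, the
    preimage of a closed set under [h] is the [q]-image of a compact part of [A]. *)
Lemma quotient_within_continuous (X Y Z : topologicalType) (A : set X)
    (q : X -> Y) (h : Y -> Z) :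
  compact A -> hausdorff_space Y -> continuous q ->
  {within A, continuous (h \o q)} -> {within q @` A, continuous h}.
Proof.
move=> cA hY cq chq; apply/continuous_closedP => C cC.
have /continuous_closedP/(_ C cC)/closed_subspaceP[D cD DE] := chq.
apply/closed_subspaceP; exists (q @` (D `&` A)).
  apply: compact_closed => //; apply: continuous_compact.
    exact: continuous_subspaceT.
  by rewrite setIC; apply: compact_closedI.
rewrite eqEsubset; split => y /=.
  move=> [[x [Dx Ax] <-] _]; split; last by exists x.
  by have [] : ((h \o q) @^-1` C `&` A) x by rewrite -DE.
move=> [Ch [x Ax] xy]; split; last by exists x.
suff DAx : (D `&` A) x by exists x.
by rewrite DE; split => //; rewrite -xy in Ch.
Qed.

Lemma hausdorff_prod (X Y : topologicalType) :
  hausdorff_space X -> hausdorff_space Y -> hausdorff_space (X * Y)%type.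
Proof.
move=> hX hY [x y] [x' y'] xy_cl; congr pair.
- apply: hX => U V nU nV.
  have [||[a b] [/= aU aV]] := xy_cl (fst @^-1` U) (fst @^-1` V).
  + exact: (cvg_fst (F := nbhs x) (G := nbhs y)).
  + exact: (cvg_fst (F := nbhs x') (G := nbhs y')).
  by exists a.
- apply: hY => U V nU nV.
  have [||[a b] [/= aU aV]] := xy_cl (snd @^-1` U) (snd @^-1` V).
  + exact: (cvg_snd (F := nbhs x) (G := nbhs y)).
  + exact: (cvg_snd (F := nbhs x') (G := nbhs y')).
  by exists b.
Qed.

(* [q] exhibits its image as [A / A0]; the homotopy [G] contracts [A0] within
   itself, so it descends to the quotient. *)
Lemma quotient_homotopy_equivalent (R : realType) (X Y : topologicalType)
    (A A0 : set X) (q : X -> Y) (G : R * X -> X) (p : X) :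
  compact A -> hausdorff_space Y -> continuous q -> continuous G ->
  A0 `<=` A ->
  (forall x y, A x -> A y -> q x = q y -> x = y \/ A0 x /\ A0 y) ->
  (forall x y, A0 x -> A0 y -> q x = q y) ->
  (forall (t : R) x, 0 <= t <= 1 -> A x -> A (G (t, x))) ->
  (forall (t : R) x, 0 <= t <= 1 -> A0 x -> A0 (G (t, x))) ->
  (forall x, A x -> G (0, x) = x) ->
  (forall x, A0 x -> G (1, x) = p) ->
  homotopy_equivalent R A (q @` A).
Proof.
move=> cA hY cq cG A0A q_inj q_cst GA GA0 G0 G1.
(* A set-theoretic section, with no continuity; it only enters through expressions that are constant
   on the fibres of [q]. *)
pose s y := xget p [set x | A x /\ q x = y].
have sP y : (q @` A) y -> A (s y) /\ q (s y) = y.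
  move=> [x Ax xy]; apply: (@xgetPex _ p [set x | A x /\ q x = y]).
  by exists x.
have G_cst t x y : 0 <= t <= 1 -> A x -> A y -> q x = q y ->
    q (G (t, x)) = q (G (t, y)).
  move=> t01 Ax Ay /(q_inj _ _ Ax Ay)[->//|[A0x A0y]].
  by apply: q_cst; apply: GA0.
have G1_cst x y : A x -> A y -> q x = q y -> G (1, x) = G (1, y).
  by move=> Ax Ay /(q_inj _ _ Ax Ay)[->//|[A0x A0y]]; rewrite !G1.
have qsq x : A x -> A (s (q x)) /\ q (s (q x)) = q x by move=> Ax; apply: sP; exists x.
have t1 : 0 <= (1 : R) <= 1 by rewrite lexx ler01.
have cG1 : continuous (fun x => G (1, x)).
  have c1 : continuous (fun x : X => (1 : R, x)).
    by apply: continuous_pair => x; [exact: cvg_cst | exact: cvg_id].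
  exact: continuous_compT c1 cG.
exists q, (fun y => G (1, s y)); split.
- split=> [a Aa|b Bb]; first by exists a.
  by apply: GA => //; have [] := sP b Bb.
- exact: continuous_subspaceT.
- apply: quotient_within_continuous => //.
  apply: (@subspace_eq_continuous _ A _ (fun x => G (1, x))); last first.
    exact: continuous_subspaceT.
  move=> x; rewrite inE => Ax /=.
  by have [As qs] := qsq x Ax; apply: G1_cst.
- exists G; split => //; first exact: continuous_subspaceT.
  move=> a Aa /=; have [As qs] := qsq a Aa.
  exact: G1_cst.
- exists (fun ty => q (G (ty.1, s ty.2))); split => /=.
  (* Continuity again descends from a compact set, now [I01] times [A], along the identity times
     [q]. *)
  + pose I01 := [set t : R | 0 <= t <= 1].
    have -> : [set t : R | 0 <= t <= 1] `*` q @` A =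
        (fun tx : R * X => (tx.1, q tx.2)) @` (I01 `*` A).
      rewrite eqEsubset; split => [[t y] /= [t01 [x Ax xy]]|_ [[t x] /= [t01 Ax] <-]].
        by exists (t, x) => //=; rewrite xy.
      by split => //=; exists x.
    apply: quotient_within_continuous.
    * apply: compact_setX => //.
      have -> : I01 = `[0, 1]%classic by rewrite /I01; apply/seteqP; split=> t; rewrite /= in_itv.
      exact: segment_compact.
    * by apply: hausdorff_prod => //; exact: Rhausdorff.
    * apply: continuous_pair; first by move=> x; exact: cvg_fst.
      by apply: continuous_compT cq => x; exact: cvg_snd.
    apply: (@subspace_eq_continuous _ _ _ (q \o G)); last first.
      exact/continuous_subspaceT/continuous_compT.
    move=> [t x]; rewrite inE => -[/= t01 Ax] /=.
    by have [As qs] := qsq x Ax; apply: G_cst.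
  + by move=> t b t01 /sP[As _]; exists (G (t, s b)) => //; apply: GA.
  + by move=> b /sP[As qs]; rewrite G0.
  + by [].
Qed.

(** * Realizations *)

Lemma continuous_bigprod (R : realType) (X : topologicalType) (I : Type)
    (r : seq I) (P : pred I) (f : I -> X -> R) :
  (forall i, continuous (f i)) ->
  continuous (fun x => \prod_(i <- r | P i) f i x).
Proof.
move=> cf x; apply: cvg_big => [|i _]; last exact: cf.
exact: mul_continuous.
Qed.

Section MinOver.
Variables (R : realType) (V : finType).
Implicit Types (C : {set V}) (x : V -> R).

(** For nonnegative [x] this is positive exactly when the support of [x] contains [C]. The starting
    value 1 does not disturb the minimum over a nonempty [C], since barycentric coordinates are at
    most 1. *)
Definition min_over C x : R := \big[Num.min/1]_(v in C) x v.

Lemma continuous_min_over C :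
  continuous (min_over C : {ptws V -> R} -> R).
Proof. by apply: continuous_bigmin => v; exact: eval_continuous. Qed.

Lemma min_over_le C x v : v \in C -> min_over C x <= x v.
Proof. exact: bigmin_le_cond. Qed.

Lemma min_over_ge0 C x : (forall v, 0 <= x v) -> 0 <= min_over C x.
Proof. by move=> x0; apply: le_bigmin. Qed.

Lemma min_over_gt0 C x : (forall v, v \in C -> 0 < x v) -> 0 < min_over C x.
Proof. by move=> x0; apply: lt_bigmin. Qed.

Lemma min_over_attained C x : C != finset.set0 -> (forall v, x v <= 1) ->
  exists2 v, v \in C & min_over C x = x v.
Proof.
move=> /set0Pn[v0 v0C] x1.
rewrite /min_over (bigmin_eq_arg _ _ _ _ v0C) => [|v _]; last exact: x1.
by case: arg_minP => // v vC _; exists v.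
Qed.

Lemma min_over_eq0 C x v : (forall v, 0 <= x v) -> v \in C -> x v = 0 ->
  min_over C x = 0.
Proof.
move=> x0 vC xv; apply/eqP; rewrite eq_le min_over_ge0// andbT -xv.
exact: min_over_le.
Qed.

End MinOver.

Section Realization.
Variables (R : realType) (V : finType).
Implicit Types (K : pred {set V}) (x : {ptws V -> R}).

Definition down_closed K := forall s t : {set V}, K s -> t \subset s -> K t.

Definition supp x : {set V} := finset (fun v => x v != 0).

Lemma in_supp x v : (v \in supp x) = (x v != 0).
Proof. by rewrite inE. Qed.

Lemma realization_le1 K x v : realization K x -> x v <= 1.
Proof.
move=> [x0 [x1 _]]; rewrite -x1 (bigD1 v) //= lerDl.
by apply: sumr_ge0 => w _; exact: x0.
Qed.

Lemma realization_sub K K' : (forall s, K s -> K' s) ->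
  @realization R V K `<=` @realization R V K'.
Proof. by move=> KK' x [x0 [x1 /KK']]. Qed.

(** The realization is closed in a cube: the support condition says that, for every non-face [s],
    the product of the coordinates over [s] vanishes. *)
Lemma compact_realization K : down_closed K -> compact (@realization R V K).
Proof.
move=> Kd.
have cI : compact [set x : {ptws V -> R} | forall v, `[0, 1]%classic (x v)].
  apply: (@tychonoff V (fun=> R) (fun=> `[0, 1]%classic)) => v.
  exact: segment_compact.
apply: subclosed_compact cI _; last first.
  move=> x Kx v; rewrite /= in_itv /= (realization_le1 _ Kx) andbT.
  by case: Kx.
have -> : realization K =
    (\bigcap_v [set x : {ptws V -> R} | 0 <= x v]) `&`
    [set x : {ptws V -> R} | \sum_v x v = 1] `&`
    \bigcap_(s in [set s | ~~ K s]) [set x : {ptws V -> R} | \prod_(v in s) x v = 0].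
  apply/seteqP; split=> x.
    move=> [x0 [x1 Kx]]; split; first by split => // v _; exact: x0.
    move=> s /= nKs; apply/eqP/prodf_eq0.
    have /subsetPn[v vs] : ~~ (s \subset supp x).
      by apply: contra nKs; exact: Kd.
    by rewrite in_supp negbK => xv; exists v.
  move=> [[/= x0 x1] Kx]; split; first by move=> v; exact: x0.
  split => //; apply/negPn/negP => nK.
  have /eqP/prodf_eq0[v] := Kx _ nK.
  by rewrite inE => /negP.
apply: closedI; first apply: closedI.
- apply: closed_bigI => v _.
  apply: (@closed_comp _ _ (fun x : {ptws V -> R} => x v) [set t | 0 <= t]).
    by move=> x _; exact: eval_continuous.
  exact: closed_ge.
- apply: (@closed_comp _ _ (fun x : {ptws V -> R} => \sum_v x v) [set 1]).
    by move=> x _; apply: continuous_bigsum => v; exact: eval_continuous.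
  exact: closed_eq.
- apply: closed_bigI => s _.
  apply: (@closed_comp _ _ (fun x : {ptws V -> R} => \prod_(v in s) x v) [set 0]).
    by move=> x _; apply: continuous_bigprod => v; exact: eval_continuous.
  exact: closed_eq.
Qed.

End Realization.

(** * Contractions of the ambient space *)

Lemma continuous_fst (X Y : topologicalType) : continuous (@fst X Y).
Proof. by move=> x; exact: cvg_fst. Qed.

Lemma continuous_snd (X Y : topologicalType) : continuous (@snd X Y).
Proof. by move=> x; exact: cvg_snd. Qed.

Section RealOps.
Variables (R : realType) (X : topologicalType) (f g : X -> R).
Hypotheses (cf : continuous f) (cg : continuous g).

Lemma continuous_add : continuous (fun x => f x + g x).
Proof. by move=> x; apply: cvgD; [exact: cf | exact: cg]. Qed.

Lemma continuous_sub : continuous (fun x => f x - g x).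
Proof. by move=> x; apply: cvgB; [exact: cf | exact: cg]. Qed.

Lemma continuous_mul : continuous (fun x => f x * g x).
Proof. by move=> x; apply: cvgM; [exact: cf | exact: cg]. Qed.

Lemma continuous_minr : continuous (fun x => Num.min (f x) (g x)).
Proof. by move=> x; apply: (@continuous_min R X f g); [exact: cf | exact: cg]. Qed.

Lemma continuous_maxr : continuous (fun x => Num.max (f x) (g x)).
Proof. by move=> x; apply: (@continuous_max R X f g); [exact: cf | exact: cg]. Qed.

Lemma continuous_div : (forall x, g x != 0) -> continuous (fun x => f x / g x).
Proof.
move=> g0 x; apply: cvgM; first exact: cf.
by apply: cvgV => //; exact: cg.
Qed.

End RealOps.

Section Contraction.
Variables (R : realType) (V : finType).
Implicit Types (K : pred {set V}) (x : {ptws V -> R}).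

(* The homotopy is defined and continuous on the whole ambient space and starts
   at the identity there: it can then be composed with other maps without any
   gluing of continuous functions on closed pieces. *)
Definition ambient_contraction K (H : R * {ptws V -> R} -> {ptws V -> R}) p :=
  [/\ continuous H, forall x, H (0, x) = x,
      forall (t : R) x, 0 <= t <= 1 -> realization K x -> realization K (H (t, x)),
      forall x, realization K x -> H (1, x) = p
    & realization K p].

Definition ambient_contractible K := exists H p, ambient_contraction K H p.

(** Straight-line homotopy to the apex [T]. *)
Lemma cone_contractible K (T : V) :
  K finset.set0 -> (forall s, K s -> K (T |: s)) -> down_closed K ->
  ambient_contractible K.
Proof.
move=> K0 KT Kd.
pose H (tx : R * {ptws V -> R}) : {ptws V -> R} :=
  fun v => (1 - tx.1) * tx.2 v + tx.1 * (v == T)%:R.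
pose p : {ptws V -> R} := fun v => (v == T)%:R.
have sum_p : \sum_v p v = 1.
  by rewrite (bigD1 T) //= big1 /p ?eqxx ?addr0// => v /negPf ->.
have HK (t : R) x : 0 <= t <= 1 -> realization K x -> realization K (H (t, x)).
  move=> /andP[t0 t1] [x0 [x1 Kx]]; split; [|split] => /=.
  - move=> v; rewrite /H /=; apply: addr_ge0; apply: mulr_ge0 => //.
    by rewrite subr_ge0.
  - by rewrite /H /= big_split /= -!mulr_sumr x1 -/(p _) sum_p; ring.
  - apply: Kd (KT _ Kx) _; apply/fintype.subsetP => v; rewrite !inE /H /=.
    by case: (eqVneq v T) => //= vT; rewrite mulr0 addr0; apply: contra_neq => ->; rewrite mulr0.
have H1 x : H (1, x) = p.
  by apply/funext => v; rewrite /H /p /= subrr mul0r add0r mul1r.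
exists H, p; split => //.
- apply: ptws_continuous => v; rewrite /H.
  have c1 : continuous (fun tx : R * {ptws V -> R} => tx.1) by exact: continuous_fst.
  have c2 : continuous (fun tx : R * {ptws V -> R} => tx.2) by exact: continuous_snd.
  apply: continuous_add; apply: continuous_mul => //.
  + by apply: continuous_sub => //; exact: cst_continuous.
  + exact: (continuous_compT c2 (@eval_continuous V R v)).
  + exact: cst_continuous.
- by move=> x; apply/funext => v; rewrite /H /= subr0 mul1r mul0r addr0.
- split; first by move=> v; rewrite /p.
  split => //.
  apply: Kd (KT _ K0) _; apply/fintype.subsetP => v; rewrite !inE /p.
  by case: (v == T); rewrite //= eqxx.
Qed.

(** A face containing [C] can trade a vertex of [C] for [T], so the realization deforms into the
    part without [C], where the given contraction takes over. *)
Lemma collapse_contractible K (C : {set V}) (T : V) :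
  down_closed K -> C != finset.set0 -> T \notin C ->
  (forall s, K s -> C \subset s -> K (T |: s)) ->
  ambient_contractible (fun s => K s && ~~ (C \subset s)) ->
  ambient_contractible K.
Proof.
move=> Kd C0 TC KT [H [p [cH H0 HK H1 Kp]]].
set K' : pred {set V} := (fun s => K s && _) in HK H1 Kp.
have K'K : realization K' `<=` @realization R V K.
  by apply: realization_sub => s /andP[].
(* Push mass from the vertices of [C] to [T] until one of them vanishes. *)
pose r (sx : R * {ptws V -> R}) : {ptws V -> R} := fun v =>
  sx.2 v + sx.1 * min_over C sx.2 * (#|C|%:R * (v == T)%:R - (v \in C)%:R).
have r0 x : r (0, x) = x by apply/funext => v; rewrite /r /= !mul0r addr0.
have cr : continuous r.
  apply: ptws_continuous => v; rewrite /r.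
  have c1 : continuous (fun tx : R * {ptws V -> R} => tx.1) by exact: continuous_fst.
  have c2 : continuous (fun tx : R * {ptws V -> R} => tx.2) by exact: continuous_snd.
  apply: continuous_add; first exact: (continuous_compT c2 (@eval_continuous V R v)).
  apply: continuous_mul; last exact: cst_continuous.
  by apply: continuous_mul => //; exact: (continuous_compT c2 (@continuous_min_over R V C)).
have r_id s x : realization K x -> ~~ (C \subset supp x) -> r (s, x) = x.
  move=> [x0 _] /subsetPn[v vC]; rewrite in_supp negbK => /eqP xv.
  by apply/funext => w; rewrite /r /= (min_over_eq0 x0 vC xv) mulr0 mul0r addr0.
have rE_T s x : r (s, x) T = x T + s * min_over C x * #|C|%:R.
  rewrite /r /= eqxx (negPf TC). rewrite /=; ring.
have rE_C s x v : v \in C -> r (s, x) v = x v - s * min_over C x.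
  move=> vC; have /negPf vT : v != T by apply: contraNneq TC => <-.
  by rewrite /r /= vT vC /=; ring.
have rE_D s x v : v \notin C -> v != T -> r (s, x) v = x v.
  by move=> /negPf vC /negPf vT; rewrite /r /= vT vC /=; ring.
have sumC : \sum_v (v \in C)%:R = #|C|%:R :> R.
  by rewrite -sum1_card natr_sum [RHS]big_mkcond; apply: eq_bigr => v _; case: ifP.
have rK (s : R) x : 0 <= s <= 1 -> realization K x -> realization K (r (s, x)).
  move=> /andP[s0 s1] Kx; have [Cx|/(r_id s x Kx) ->//] := boolP (C \subset supp x).
  case: (Kx) => x0 [x1 Kx'].
  have m0 : 0 <= min_over C x by exact: min_over_ge0.
  split; [|split].
  - move=> v; have [->|vT] := eqVneq v T.
      by rewrite rE_T addr_ge0// mulr_ge0// mulr_ge0.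
    have [vC|vC] := boolP (v \in C); last by rewrite rE_D.
    rewrite rE_C// subr_ge0 (le_trans _ (min_over_le x vC))//.
    by rewrite ler_piMl.
  (* Total mass is kept: [T] gains [#|C|] times what each vertex of [C] loses. *)
  - rewrite /r /= big_split /= x1 -mulr_sumr sumrB -mulr_sumr.
    rewrite (bigD1 T) //= eqxx big1 => [|v /negPf ->//].
    by rewrite sumC addr0 mulr1 subrr mulr0 addr0.
  - apply: Kd (KT _ Kx' Cx) _; apply/fintype.subsetP => v; rewrite !inE.
    case: (eqVneq v T) => //= vT.
    have [vC _|vC] := boolP (v \in C); last by rewrite rE_D.
    by move/fintype.subsetP: Cx => /(_ v vC); rewrite in_supp.
have rK' x : realization K x -> realization K' (r (1, x)).
  move=> Kx; have := rK 1 x; rewrite lexx ler01 => /(_ isT Kx) [r0' [r1' Kr]].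
  split; [|split] => //; apply/andP; split => //.
  have [Cx|nCx] := boolP (C \subset supp x); last by rewrite r_id.
  have [v vC vm] := min_over_attained C0 (fun v => realization_le1 v Kx).
  apply/subsetPn; exists v => //.
  by rewrite inE rE_C// mul1r vm subrr eqxx.
(* The push runs up to time 1/2 and the contraction afterwards. Clamping both times gives a single
   formula, because [H] is the identity at time 0. *)
exists (fun tx => H (Num.max 0 (2 * tx.1 - 1), r (Num.min 1 (2 * tx.1), tx.2))), p.
split.
- have c1 : continuous (fun tx : R * {ptws V -> R} => tx.1) by exact: continuous_fst.
  have c2 : continuous (fun tx : R * {ptws V -> R} => tx.2) by exact: continuous_snd.
  have c21 : continuous (fun tx : R * {ptws V -> R} => 2 * tx.1).
    by apply: continuous_mul => //; exact: cst_continuous.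
  have cr1 : continuous (fun tx : R * {ptws V -> R} => r (Num.min 1 (2 * tx.1), tx.2)).
    apply: continuous_compT cr; apply: continuous_pair => //.
    by apply: continuous_minr => //; exact: cst_continuous.
  apply: continuous_compT cH; apply: continuous_pair => //.
  apply: continuous_maxr; first exact: cst_continuous.
  by apply: continuous_sub => //; exact: cst_continuous.
- by move=> x /=; rewrite mulr0 sub0r (max_l (lerN10 _)) (min_r ler01) r0 H0.
- move=> t x /andP[t0 t1] Kx /=; have [t2|t2] := leP (2 * t) 1.
    rewrite max_l ?subr_le0// H0; apply: rK => //.
    by rewrite t2 mulr_ge0.
  rewrite max_r; last by rewrite subr_ge0 ltW.
  apply: K'K; apply: HK; last exact: rK'.
  by apply/andP; split; lra.
- move=> x Kx /=; rewrite mulr1 min_l ?ler1n// max_r; last by lra.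
  by rewrite (_ : 2 - 1 = 1 :> R); [apply: H1; exact: rK' | lra].
- exact: K'K.
Qed.

(** [P] lists the allowed traces of faces on [A]. By induction on its size, a largest trace [C] is
    collapsed away, since an allowed face containing [C] has trace exactly [C]. When only the empty
    trace is left, the complex is a cone. *)
Lemma stratified_contractible K (A : {set V}) (P : {set {set V}}) :
  down_closed K -> K finset.set0 -> finset.set0 \in P ->
  (forall C D : {set V}, C \in P -> D \subset C -> D \in P) ->
  (forall C, C \in P -> C \subset A) ->
  (forall C, C \in P -> exists2 T, T \notin A &
     forall s, K s -> s :&: A = C -> K (T |: s)) ->
  ambient_contractible (fun s => K s && (s :&: A \in P)).
Proof.
move=> Kd K0; elim: {P}#|P| {-2}P (erefl #|P|) => [P /eqP|n IHn P cP P0 Pd PA PT].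
  by rewrite cards_eq0 => /eqP -> ; rewrite inE.
have Kd' : down_closed (fun s => K s && (s :&: A \in P)).
  move=> s t /andP[Ks sP] ts; apply/andP; split; first exact: Kd ts.
  exact: Pd sP (finset.setSI _ ts).
have TA_I (T : V) (s : {set V}) : T \notin A -> (T |: s) :&: A = s :&: A.
  move=> TA; apply/setP => v; rewrite !inE; case: eqVneq => [->|//].
  by rewrite (negPf TA) !andbF.
have [C CP C_max] : exists2 C, C \in P & forall D, D \in P -> (#|D| <= #|C|)%N.
  by case: (arg_maxnP (fun C : {set V} => #|C|) P0) => C CP Cm; exists C.
have [T TA KT] := PT C CP.
have [C0|C0] := eqVneq C finset.set0.
  apply: (@cone_contractible _ T) => //; first by rewrite K0 finset.set0I.
  move=> s /andP[Ks sP]; rewrite TA_I// sP andbT; apply: KT => //.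
  by apply/eqP; rewrite C0 -cards_eq0 -leqn0 (leq_trans (C_max _ sP))// C0 cards0.
have CsE s : s :&: A \in P -> C \subset s -> s :&: A = C.
  move=> sP Cs; apply/esym/eqP; rewrite eqEcard C_max// andbT.
  by rewrite finset.subsetI Cs PA.
apply: (@collapse_contractible _ C T) => //.
- by apply: contra TA; apply/fintype.subsetP/PA.
- move=> s /andP[Ks sP] Cs; rewrite TA_I// sP andbT; apply: KT => //.
  exact: CsE.
(* Discarding the faces that contain [C] amounts to deleting [C] from [P]. *)
rewrite (_ : (fun s => _) = (fun s => K s && (s :&: A \in P :\ C))); last first.
  apply/funext => s; rewrite !inE -andbA; congr (_ && _).
  have [sP|] := boolP (s :&: A \in P); last by rewrite andbF.
  rewrite andbT /=; congr negb; apply/idP/eqP => [/CsE->//|<-].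
  exact: finset.subsetIl.
apply: IHn.
- by have := cardsD1 C P; rewrite CP cP => -[].
- by rewrite !inE eq_sym C0.
- move=> D E; rewrite !inE => /andP[DC DP] ED; rewrite (Pd _ _ DP ED) andbT.
  by apply: contra DC => /eqP EC; rewrite eq_sym eqEcard C_max// andbT -EC.
- by move=> D; rewrite !inE => /andP[_ /PA].
- by move=> D; rewrite !inE => /andP[_ /PT].
Qed.

End Contraction.

(** * Attaching facets to a contractible subcomplex *)

Section AttachFacets.
Variables (R : realType) (V : finType) (K : pred {set V}) (k M : nat).
Variable c : 'I_M -> {set V}.
Hypotheses (Kd : down_closed K) (c_inj : injective c).
Hypotheses (c_card : forall j, #|c j| = k.+1) (cK : forall j, K (c j)).
Hypothesis c_max : forall j s, K s -> c j \subset s -> s = c j.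

Let K' : pred {set V} := fun s => K s && (s \notin codom c).

Implicit Types (x y : {ptws V -> R}) (j : 'I_M).

Let n1 : R := k.+1%:R.
(** The common coordinate of the barycentre of a facet. *)
Let b : R := n1^-1.

Lemma n1_gt0 : 0 < n1. Proof. by rewrite ltr0n. Qed.
Lemma b_gt0 : 0 < b. Proof. by rewrite invr_gt0 n1_gt0. Qed.
Lemma n1b : n1 * b = 1. Proof. by rewrite divff// gt_eqF// n1_gt0. Qed.

Definition vtx j (i : 'I_k.+1) : V := enum_val (cast_ord (esym (c_card j)) i).

Lemma vtx_in j i : vtx j i \in c j. Proof. exact: enum_valP. Qed.

Lemma vtx_inj j : injective (vtx j).
Proof. by move=> i i' /enum_val_inj/cast_ord_inj. Qed.

Lemma vtx_surj j v : v \in c j -> exists i, v = vtx j i.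
Proof.
move=> vc; exists (cast_ord (c_card j) (enum_rank_in vc v)).
by rewrite /vtx cast_ordK enum_rankK_in.
Qed.

Lemma sum_vtx j (f : V -> R) : \sum_(v in c j) f v = \sum_i f (vtx j i).
Proof.
rewrite big_enum_val /=.
rewrite (reindex (cast_ord (esym (c_card j)))) //=; apply: onW_bij.
by exists (cast_ord (c_card j)) => i; apply: val_inj.
Qed.

(** The first [k] vertices serve as coordinates on a facet; total mass 1 determines the last one. *)
Let low (i : 'I_k) : 'I_k.+1 := widen_ord (leqnSn k) i.

(** On the realization of [K], maximality of the facets makes [q j] positive exactly on the open
    facet [c j]. *)
Let q j x : R := min_over (c j) x.

Lemma q_ge0 j x : (forall v, 0 <= x v) -> 0 <= q j x.
Proof. exact: min_over_ge0. Qed.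

Lemma facet_supp j x : realization K x -> q j x != 0 -> supp x = c j.
Proof.
move=> [x0 [_ Kx]] qx; apply: c_max => //; apply/fintype.subsetP => v vc.
by rewrite in_supp; apply: contra_neq qx; exact: min_over_eq0.
Qed.

Lemma facet_q_gt0 j x : realization K x -> supp x = c j -> 0 < q j x.
Proof.
move=> [x0 _] xc; apply: min_over_gt0 => v.
by rewrite -xc in_supp lt0r x0 andbT.
Qed.

Lemma facet_sum j x : realization K x -> supp x = c j -> \sum_(v in c j) x v = 1.
Proof.
move=> [_ [x1 _]] xc; rewrite -x1 big_mkcond /=; apply: eq_bigr => v _.
by rewrite -xc in_supp; case: eqVneq.
Qed.

Lemma facet_q_other j j' x : realization K x -> supp x = c j -> j' != j ->
  q j' x = 0.
Proof.
move=> Kx xc jj'; apply/eqP; apply: contraNT jj' => /(facet_supp Kx).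
by rewrite xc => /c_inj ->.
Qed.

Lemma realizationK'P x :
  realization K' x <-> realization K x /\ forall j, q j x = 0.
Proof.
split=> [[x0 [x1 /andP[Kx xc]]]|[Kx qx]].
  have Kx' : realization K x by [].
  split=> // j; apply/eqP; apply: contraNT xc => /(facet_supp Kx') xc.
  by apply/codomP; exists j.
case: (Kx) => x0 [x1 Kx']; split; [|split] => //; apply/andP; split => //.
apply/codomP => -[j xc].
by have := facet_q_gt0 Kx xc; rewrite qx ltxx.
Qed.

Lemma K'K : realization K' `<=` @realization R V K.
Proof. by move=> x /realizationK'P[]. Qed.

Lemma facet_or x : realization K x ->
  realization K' x \/ exists j, supp x = c j.
Proof.
move=> Kx; have [qx|] := pselect (forall j, q j x = 0).
  by left; apply/realizationK'P.
by move/existsNP => [j /eqP /(facet_supp Kx) xc]; right; exists j.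
Qed.

(* The quotient map onto the wedge: on the [j]-th facet it is the radial
   homeomorphism [u / q] from the open simplex to the affine space, followed by
   the inverse of the stereographic projection from the origin. *)

Let u j x (i : 'I_k) : R := x (vtx j (low i)) - b.

(* The last square vanishes on the facet [c j] and keeps the denominator positive elsewhere. *)
Let D j x : R :=
  \sum_i u j x i ^+ 2 + q j x ^+ 2 + (1 - \sum_(v in c j) x v) ^+ 2.

(** On the facet, the inversion [2 z / |z|^2] at [z = (u / q, 1)] lands on the unit sphere centred
    at [e_j]; clearing [q] turns it into [w (u, q)], which extends by 0 to where [q] vanishes. *)
Let w j x : R := 2 * q j x / D j x.

Definition wedge_map x : {ptws ('I_k + 'I_M)%type -> R} := fun a =>
  match a with
  | inl i => \sum_j w j x * u j x i
  | inr j => w j x * q j x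
  end.

(** If all the squares vanished, the first [k] coordinates would be [b], and the sum 1 would force
    [b] on the last as well; the minimum [q] would then be positive. *)
Lemma D_gt0 j x : 0 < D j x.
Proof.
have s0 : 0 <= \sum_i u j x i ^+ 2 by apply: sumr_ge0 => i _; exact: sqr_ge0.
have sq0 := addr_ge0 s0 (sqr_ge0 (q j x)).
rewrite lt_neqAle addr_ge0 ?sqr_ge0// andbT eq_sym paddr_eq0 ?sqr_ge0//.
rewrite paddr_eq0 ?sqr_ge0// !sqrf_eq0 -andbA; apply/negP => /and3P[/eqP su /eqP q0].
rewrite subr_eq0 eq_sym => /eqP sx.
have ub i : x (vtx j (low i)) = b.
  have : u j x i ^+ 2 = 0 by apply: (psumr_eq0P _ su) => // i' _; exact: sqr_ge0.
  by move/eqP; rewrite sqrf_eq0 subr_eq0 => /eqP.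
have xb v : v \in c j -> x v = b.
  move=> /vtx_surj[i ->]; move: sx; rewrite sum_vtx big_ord_recr /=.
  rewrite (eq_bigr (fun=> b)) => [|i' _]; last exact: ub.
  rewrite sumr_const card_ord -mulr_natl => sx.
  case: (unliftP ord_max i) => [i' ->|->].
    rewrite -(ub i'); congr (x (vtx _ _)); apply: val_inj => /=.
    by rewrite /bump leqNgt ltn_ord.
  have := n1b; rewrite /n1 -natr1 mulrDl mul1r => nb.
  by apply: (addrI (k%:R * b)); rewrite sx nb.
have : 0 < q j x by apply: min_over_gt0 => v /xb ->; exact: b_gt0.
by rewrite q0 ltxx.
Qed.

Lemma w_q0 j x : q j x = 0 -> w j x = 0.
Proof. by rewrite /w => ->; rewrite mulr0 mul0r. Qed.

Lemma w_gt0 j x : 0 < q j x -> 0 < w j x.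
Proof. by move=> q0; rewrite divr_gt0 ?D_gt0// mulr_gt0. Qed.

Lemma wedge_map_facet j x i : realization K x -> supp x = c j ->
  wedge_map x (inl i) = w j x * u j x i.
Proof.
move=> Kx xc; rewrite /= (bigD1 j) //= big1 ?addr0// => j' jj'.
by rewrite w_q0 ?mul0r//; exact: facet_q_other xc jj'.
Qed.

Lemma wedge_map_K' x : realization K' x -> wedge_map x = fun=> 0.
Proof.
move=> /realizationK'P[_ qx]; apply/funext => -[i|j] /=; last by rewrite qx mulr0.
by rewrite big1 // => j _; rewrite w_q0 ?mul0r.
Qed.

Lemma continuous_wedge_map : continuous wedge_map.
Proof.
have cx v : continuous (fun x : {ptws V -> R} => x v) := @eval_continuous V R v.
have cq j : continuous (q j) := @continuous_min_over R V (c j).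
have cu j i : continuous (fun x => u j x i).
  by apply: continuous_sub; [exact: cx | exact: cst_continuous].
have sq (f : {ptws V -> R} -> R) : continuous f -> continuous (fun x => f x ^+ 2).
  by move=> cf; rewrite (_ : (fun x => _) = (fun x => f x * f x)); [exact: continuous_mul | exact/funext].
have cD j : continuous (D j).
  apply: continuous_add; first apply: continuous_add.
  - by apply: continuous_bigsum => i; apply: sq; exact: cu.
  - exact: sq.
  - apply: sq; apply: continuous_sub; first exact: cst_continuous.
    exact: continuous_bigsum.
have cw j : continuous (w j).
  apply: continuous_div => //; last by move=> x; rewrite gt_eqF// D_gt0.
  by apply: continuous_mul => //; exact: cst_continuous.
apply: ptws_continuous => -[i|j] /=; last exact: continuous_mul.
by apply: continuous_bigsum => j; exact: continuous_mul.
Qed.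

(** At a vertex [v] where [x] is minimal, [(q x - b) q y = (y v - b) q x >= (q y - b) q x]. Used in
    both directions, this shows that points with equal [(x - b) / q] have equal [q]. *)
Lemma cross_ratio_le (x y : V -> R) j : (forall v, x v <= 1) -> 0 < q j x ->
  (forall v, v \in c j -> (x v - b) * q j y = (y v - b) * q j x) ->
  q j y <= q j x.
Proof.
move=> x1 qx xy; have c0 : c j != finset.set0 by rewrite -card_gt0 c_card.
have [v vc qxv] := min_over_attained c0 x1.
have := xy v vc; rewrite -qxv -/(q j x) => eqv.
have yv : q j y <= y v by exact: min_over_le.
have : q j y * q j x <= y v * q j x by rewrite ler_pM2r.
have := b_gt0 => b0 le1.
suff : b * q j y <= b * q j x by rewrite ler_pM2l.
by nra.
Qed.

(** The coordinate [inr j] detects the open facet [c j]; dividing the [inl] coordinates by it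
    recovers [u / q], and [cross_ratio_le] then recovers [q]. *)
Lemma wedge_map_inj x y : realization K x -> realization K y ->
  wedge_map x = wedge_map y -> x = y \/ realization K' x /\ realization K' y.
Proof.
move=> Kx Ky xy.
have qxy j : (q j x == 0) = (q j y == 0).
  have wE z : (wedge_map z (inr j) == 0) = (q j z == 0).
    rewrite /= /w mulf_eq0 !mulf_eq0 pnatr_eq0 /= invr_eq0 (gt_eqF (D_gt0 _ _)).
    by rewrite orbF orbb.
  by rewrite -!wE xy.
have [K'x|[j xc]] := facet_or Kx.
  right; split => //; apply/realizationK'P; split => // j.
  by apply/eqP; rewrite -qxy; apply/eqP; case/realizationK'P: K'x.
left; have qx := facet_q_gt0 Kx xc.
have yc : supp y = c j by apply: facet_supp; rewrite // -qxy gt_eqF.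
have qy := facet_q_gt0 Ky yc.
have wx := w_gt0 qx; have wy := w_gt0 qy.
have wq : w j x * q j x = w j y * q j y := congr1 (fun f => f (inr j)) xy.
have low_eq i : (x (vtx j (low i)) - b) * q j y = (y (vtx j (low i)) - b) * q j x.
  have wu : w j x * u j x i = w j y * u j y i.
    by rewrite -!wedge_map_facet// xy.
  apply: (mulfI (lt0r_neq0 (mulr_gt0 wx wy))).
  rewrite -/(u j x i) -/(u j y i).
  transitivity ((w j x * u j x i) * (w j y * q j y)); first by ring.
  by rewrite wu -wq; ring.
have all_eq v : v \in c j -> (x v - b) * q j y = (y v - b) * q j x.
  move=> /vtx_surj[i ->].
  case: (unliftP ord_max i) => [i' ->|->].
    rewrite (_ : lift _ _ = low i') //; apply: val_inj => /=.
    by rewrite /bump leqNgt ltn_ord.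
  (* Total mass 1 carries the relation over to the last vertex. *)
  have sE z : realization K z -> supp z = c j ->
      z (vtx j ord_max) - b = - \sum_(i < k) (z (vtx j (low i)) - b).
    move=> Kz /(facet_sum Kz); rewrite sum_vtx big_ord_recr /=.
    rewrite sumrB sumr_const card_ord -mulr_natl.
    have := n1b; rewrite /n1 -natr1 mulrDl mul1r => nb sz.
    by lra.
  rewrite !sE// !mulNr !mulr_suml; congr (- _).
  by apply: eq_bigr => i' _; exact: low_eq.
have qE : q j x = q j y.
  apply/eqP; rewrite eq_le; apply/andP; split.
    apply: (@cross_ratio_le y x) => // [v|v vc]; first exact: realization_le1 Ky.
    by rewrite all_eq.
  apply: (@cross_ratio_le x y) => // v; exact: realization_le1 Kx.
apply/funext => v; have [vc|vc] := boolP (v \in c j).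
  have := all_eq v vc; rewrite qE => /(mulIf (lt0r_neq0 qy)).
  exact: addIr.
have z0 z : supp z = c j -> z v = 0.
  by move=> zc; apply/eqP; move: vc; rewrite -zc in_supp negbK.
by rewrite !z0.
Qed.


(** The origin is the image of [p]; any other point of a sphere is reached by a point on the ray
    from the barycentre in the direction prescribed by its [inl] coordinates divided by [h]. *)
Lemma wedge_map_image (p : {ptws V -> R}) : realization K' p ->
  wedge_map @` @realization R V K = @wedge_of_spheres R M k.+1.
Proof.
move=> K'p; apply/seteqP; split=> [_ [x Kx <-]|y] /=.
  have [K'x|[j xc]] := facet_or Kx; first by left=> a; rewrite wedge_map_K'.
  right; exists j; split=> [j' jj'|].
    by rewrite /= w_q0 ?mul0r//; exact: facet_q_other xc jj'.
  rewrite (eq_bigr (fun i => w j x ^+ 2 * u j x i ^+ 2)) => [|i _]; last first.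
    by rewrite -[LHS]/(wedge_map x (inl i) ^+ 2) (wedge_map_facet _ Kx xc) exprMn.
  rewrite -mulr_sumr /=.
  have : w j x * D j x = 2 * q j x by rewrite divfK// gt_eqF// D_gt0.
  rewrite /D (facet_sum Kx xc) subrr expr0n addr0 => wD.
  transitivity (w j x * (w j x * (\sum_i u j x i ^+ 2 + q j x ^+ 2))
    - 2 * w j x * q j x + 1); first by ring.
  by rewrite wD; ring.
have zero : (forall a, y a = 0) -> exists2 x, realization K x & wedge_map x = y.
  move=> y0; exists p; first exact: K'K.
  by rewrite wedge_map_K'//; apply/funext => a; rewrite y0.
move=> [/zero//|[j [yj' yj]]].
set h := y (inr j) in yj.
(* In this form the sphere equation shows that [h] is nonnegative and vanishes only at the
   origin. *)
have {}yj : \sum_(i < k) y (inl i) ^+ 2 + h ^+ 2 = 2 * h by lra.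
have s0 : 0 <= \sum_(i < k) y (inl i) ^+ 2 by apply: sumr_ge0 => i _; exact: sqr_ge0.
have [h0|h0] := eqVneq h 0.
  apply: zero => -[i|j'].
    have sy0 : \sum_(i < k) y (inl i) ^+ 2 = 0.
      by move: yj; rewrite h0 expr0n addr0 mulr0.
    have : y (inl i) ^+ 2 = 0 by apply: (psumr_eq0P _ sy0) => // i' _; exact: sqr_ge0.
    by move/eqP; rewrite sqrf_eq0 => /eqP.
  by have [->|/yj'] := eqVneq j' j.
have h_gt0 : 0 < h.
  have : 0 <= 2 * h by rewrite -yj addr_ge0// sqr_ge0.
  by rewrite pmulr_rge0// lt0r h0.
(* The required values of [(x - b) / q] at all vertices; the last entry makes their sum 0. *)
pose z (i : 'I_k.+1) : R :=
  if unlift ord_max i is Some i' then y (inl i') / h else - \sum_i y (inl i) / h.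
have zlow i : z (low i) = y (inl i) / h.
  have -> : low i = lift ord_max i by apply: val_inj; rewrite /= /bump leqNgt ltn_ord.
  by rewrite /z liftK.
have sz : \sum_i z i = 0.
  rewrite big_ord_recr /=; under eq_bigr => i _ do rewrite zlow.
  by rewrite /z unlift_none subrr.
have [i0 i0_min] : exists i0, forall i, z i0 <= z i.
  by case: (@arg_minP _ R _ (ord0 : 'I_k.+1) xpredT z isT) => i0 _ im; exists i0 => i; exact: im.
have zi0 : z i0 <= 0.
  rewrite leNgt; apply/negP => z0.
  have : 0 < \sum_i z i.
    rewrite (bigD1 i0) //= ltr_wpDr// sumr_ge0// => i _.
    by rewrite ltW// (lt_le_trans z0).
  by rewrite sz ltxx.
have z1 : 0 < 1 - z i0 by lra.
(* The point with coordinates [b + r * z i] has minimum [b + r * z i0], which has to be [q = r];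
   this is the solution of that equation. *)
pose r := b / (1 - z i0).
have r0 : 0 < r by rewrite divr_gt0// b_gt0.
have rE : b + r * z i0 = r by rewrite /r; field; rewrite gt_eqF.
clearbody r.
pose x : {ptws V -> R} := fun v => \sum_i (vtx j i == v)%:R * (b + r * z i).
have xv i : x (vtx j i) = b + r * z i.
  rewrite /x (bigD1 i) //= eqxx mul1r big1 ?addr0// => i' ii'.
  by rewrite (inj_eq (@vtx_inj j)) (negPf ii') mul0r.
have xr i : r <= x (vtx j i) by rewrite xv -{1}rE lerD2l ler_pM2l.
have x0 v : v \notin c j -> x v = 0.
  move=> vc; rewrite /x big1 // => i _; case: eqP => [iv|]; last by rewrite mul0r.
  by rewrite -iv vtx_in in vc.
have suppx : supp x = c j.
  apply/setP => v; rewrite in_supp; have [vc|/x0->] := boolP (v \in c j).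
    by have [i ->] := vtx_surj vc; rewrite gt_eqF// (lt_le_trans r0).
  by rewrite eqxx.
have sx : \sum_(v in c j) x v = 1.
  rewrite sum_vtx; under eq_bigr => i _ do rewrite xv.
  by rewrite big_split /= -mulr_sumr sz mulr0 addr0 sumr_const card_ord -mulr_natl n1b.
have Kx : realization K x.
  split; [|split].
  - move=> v; have [vc|/x0->//] := boolP (v \in c j).
    by have [i ->] := vtx_surj vc; rewrite (le_trans (ltW r0)).
  - rewrite -sx [RHS]big_mkcond; apply: eq_bigr => v _.
    by case: ifPn => // /x0.
  - by rewrite -/(supp x) suppx.
have qx : q j x = r.
  apply/eqP; rewrite eq_le; apply/andP; split.
    by rewrite -[leRHS]rE -xv; apply: min_over_le; exact: vtx_in.
  apply: le_bigmin => [|v /vtx_surj[i ->]]; last exact: xr.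
  by rewrite -(xv i0) in rE; rewrite -rE; exact: realization_le1 Kx.
have ux i : u j x i = r * (y (inl i) / h) by rewrite /u xv zlow; ring.
have wx : w j x = h / r.
  rewrite /w qx /D qx sx subrr expr0n addr0.
  rewrite (eq_bigr (fun i => r ^+ 2 / h ^+ 2 * y (inl i) ^+ 2)) => [|i _]; last first.
    by rewrite ux; field; rewrite gt_eqF.
  rewrite -mulr_sumr (_ : \sum_(i < k) _ = 2 * h - h ^+ 2); last by rewrite -yj addrK.
  have -> : r ^+ 2 / h ^+ 2 * (2 * h - h ^+ 2) + r ^+ 2 = 2 * r ^+ 2 / h by field; rewrite gt_eqF.
  by field; rewrite !gt_eqF.
exists x => //; apply/funext => -[i|j'].
  by rewrite (wedge_map_facet _ Kx suppx) ux wx; field; rewrite !gt_eqF.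
rewrite /=; have [->|jj'] := eqVneq j' j.
  by rewrite wx qx -/h; field; rewrite gt_eqF.
by rewrite yj'// w_q0 ?mul0r//; exact: facet_q_other Kx suppx jj'.
Qed.


(** The dilation stays in the simplex as long as its parameter is at most [n1 * q], where it reaches
    the boundary. The cap [Num.min t 1 / 2] keeps [1 - nu] positive for every real [t]. *)
Let nu j (t : R) x : R := Num.min (n1 * q j x) (Num.min t 1 / 2).

(* On the facet [c j] this is the dilation by [1 / (1 - nu)] from the
   barycentre; it sends the points with [n1 * q <= t / 2] to the boundary. *)
Definition stretch (tx : R * {ptws V -> R}) : {ptws V -> R} := fun v =>
  tx.2 v + \sum_j nu j tx.1 tx.2 / (1 - nu j tx.1 tx.2) * ((v \in c j)%:R * (tx.2 v - b)).

Lemma nu_lt1 j t x : nu j t x < 1.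
Proof.
rewrite /nu gt_min; apply/orP; right.
by have : Num.min t 1 <= 1 by [rewrite ge_min lexx orbT]; lra.
Qed.

Lemma continuous_stretch : continuous stretch.
Proof.
have c1 : continuous (fun tx : R * {ptws V -> R} => tx.1) by exact: continuous_fst.
have c2 : continuous (fun tx : R * {ptws V -> R} => tx.2) by exact: continuous_snd.
have cx v : continuous (fun tx : R * {ptws V -> R} => tx.2 v).
  exact: (continuous_compT c2 (@eval_continuous V R v)).
have cst (a : R) : continuous (fun tx : R * {ptws V -> R} => a) by exact: cst_continuous.
have cnu j : continuous (fun tx : R * {ptws V -> R} => nu j tx.1 tx.2).
  apply: continuous_minr; apply: continuous_mul => //.
    exact: (continuous_compT c2 (@continuous_min_over R V (c j))).
  exact: continuous_minr.
apply: ptws_continuous => v; apply: continuous_add => //.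
apply: continuous_bigsum => j; apply: continuous_mul.
  apply: continuous_div => //; first exact: continuous_sub.
  by move=> tx; rewrite subr_eq0 eq_sym lt_eqF// nu_lt1.
by apply: continuous_mul => //; exact: continuous_sub.
Qed.

Lemma stretch_id t x : (forall j, nu j t x = 0) -> stretch (t, x) = x.
Proof.
move=> nu0; apply/funext => v; rewrite /stretch /= big1 ?addr0// => j _.
by rewrite nu0 mul0r mul0r.
Qed.

(** With [e = nu j t x], the coordinates on [c j] become [(x v - b * e) / (1 - e)]. They stay
    nonnegative because [b * e <= q j x], and equality makes the smallest one vanish. *)
Lemma stretch_facet j (t : R) x : 0 <= t -> realization K x -> supp x = c j ->
  [/\ realization K (stretch (t, x)),
      nu j t x = n1 * q j x -> realization K' (stretch (t, x))
    & 0 <= nu j t x].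
Proof.
move=> t0 Kx xc; set e := nu j t x.
have qx := facet_q_gt0 Kx xc.
have e0 : 0 <= e.
  rewrite /e /nu le_min (mulr_ge0 (ltW n1_gt0) (ltW qx))/=.
  by rewrite divr_ge0// le_min t0 ler01.
have e1 : 0 < 1 - e by rewrite subr_gt0 nu_lt1.
have be : b * e <= q j x.
  have : b * e <= b * (n1 * q j x) by rewrite ler_pM2l ?b_gt0// /e /nu ge_min lexx.
  by rewrite mulrA [b * n1]mulrC n1b mul1r.
have yE v : stretch (t, x) v = x v + e / (1 - e) * ((v \in c j)%:R * (x v - b)).
  rewrite /stretch /= (bigD1 j) //= [X in _ + (_ + X)]big1 ?addr0// => j' jj'.
  suff -> : nu j' t x = 0 by rewrite !mul0r.
  rewrite /nu (facet_q_other Kx xc jj') mulr0; apply: min_l.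
  by rewrite divr_ge0// le_min t0 ler01.
have yv v : v \in c j -> stretch (t, x) v = (x v - b * e) / (1 - e).
  by move=> vc; rewrite yE vc /=; field; rewrite gt_eqF.
have x0 v : v \notin c j -> x v = 0.
  by rewrite -xc in_supp negbK => /eqP.
have y0 v : v \notin c j -> stretch (t, x) v = 0.
  by move=> vc; rewrite yE (negPf vc) x0//=; ring.
have yc : supp (stretch (t, x)) \subset c j.
  by apply/fintype.subsetP => v; rewrite in_supp; apply: contra_neqT => /y0.
have y_ge0 v : 0 <= stretch (t, x) v.
  have [vc|/y0->//] := boolP (v \in c j).
  rewrite yv// divr_ge0 ?(ltW e1)// subr_ge0 (le_trans be)//.
  exact: min_over_le.
have y1 : \sum_v stretch (t, x) v = 1.
  rewrite (bigID [in c j]) /= [X in _ + X]big1 ?addr0; last by move=> v /y0.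
  rewrite (eq_bigr (fun v => (x v - b * e) / (1 - e))) => [|v vc]; last exact: yv.
  rewrite -mulr_suml sumrB (facet_sum Kx xc) sumr_const c_card -mulr_natl.
  by rewrite mulrA -/n1 n1b mul1r divff// gt_eqF.
have Ky : realization K (stretch (t, x)).
  by split => //; split => //; apply: Kd yc.
split => // eq; split => //; split => //.
apply/andP; split; first by case: Ky => _ [].
have c0 : c j != finset.set0 by rewrite -card_gt0 c_card.
have [v vc vq] := min_over_attained c0 (fun v => realization_le1 v Kx).
have v0 : stretch (t, x) v = 0.
  by rewrite yv// -/e eq mulrA [b * n1]mulrC n1b mul1r -vq subrr mul0r.
(* The new support is a proper subset of [c j], while all facets have the same size. *)
apply/codomP => -[j' /setP sE].
have : supp (stretch (t, x)) \proper c j.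
  by apply/properP; split => //; exists v => //; rewrite in_supp v0 eqxx.
move/proper_card; rewrite (_ : supp _ = c j'); last exact/setP.
by rewrite !c_card ltnn.
Qed.

(** An explicit homotopy extension: the contraction of [K'] extends to a homotopy [G] of the whole
    realization, so collapsing [K'] to a point is a homotopy equivalence. *)
Theorem wedge_homotopy_equivalent : @ambient_contractible R V K' ->
  homotopy_equivalent R (@realization R V K) (@wedge_of_spheres R M k.+1).
Proof.
move=> [H [p [cH H0 HK H1 K'p]]].
rewrite -(wedge_map_image K'p).
(* On a facet, [late] is positive only once [t / 2] exceeds [n1 * q]; by then [stretch] has reached
   the boundary, so [H] acts at positive times only on points of [K']. On [K'] itself [late] is
   [t]. *)
pose late (tx : R * {ptws V -> R}) : R := Num.max 0 (tx.1 - 2 * \sum_j n1 * q j tx.2).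
pose G tx := H (late tx, stretch tx).
have nuK' (t : R) x : 0 <= t -> realization K' x -> forall j, nu j t x = 0.
  move=> t0 /realizationK'P[_ qx] j; rewrite /nu qx mulr0; apply: min_l.
  by rewrite divr_ge0// le_min t0 ler01.
have GK' (t : R) x : 0 <= t -> realization K' x -> G (t, x) = H (t, x).
  move=> t0 K'x; rewrite /G stretch_id; last exact: nuK'.
  rewrite /late /= big1 ?mulr0 ?subr0 ?max_r// => j _.
  by case/realizationK'P: K'x => _ ->; rewrite mulr0.
apply: (@quotient_homotopy_equivalent R _ _ _ (realization K') _ G p).
- exact: compact_realization.
- by apply: hausdorff_ptws; exact: Rhausdorff.
- exact: continuous_wedge_map.
- apply: continuous_compT cH; apply: continuous_pair; last exact: continuous_stretch.
  have c1 : continuous (fun tx : R * {ptws V -> R} => tx.1) by exact: continuous_fst.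
  have c2 : continuous (fun tx : R * {ptws V -> R} => tx.2) by exact: continuous_snd.
  have cst (a : R) : continuous (fun tx : R * {ptws V -> R} => a) by exact: cst_continuous.
  apply: continuous_maxr => //; apply: continuous_sub => //; apply: continuous_mul => //.
  apply: continuous_bigsum => j; apply: continuous_mul => //.
  exact: (continuous_compT c2 (@continuous_min_over R V (c j))).
- exact: K'K.
- exact: wedge_map_inj.
- by move=> x y K'x K'y; rewrite !wedge_map_K'.
- move=> t x /andP[t0 t1] Kx; have [K'x|[j xc]] := facet_or Kx.
    by rewrite GK'//; apply/K'K/HK => //; rewrite t0.
  have [Ky K'y nu0] := stretch_facet t0 Kx xc.
  have lateE : late (t, x) = Num.max 0 (t - 2 * (n1 * q j x)).
    rewrite /late /= (bigD1 j) //= [\sum_(_ < _ | _) _]big1 ?addr0// => j' jj'.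
    by rewrite (facet_q_other Kx xc jj') mulr0.
  rewrite /G lateE; have [tq|tq] := leP (t - 2 * (n1 * q j x)) 0.
    by rewrite H0.
  have nE : nu j t x = n1 * q j x.
    by rewrite /nu (min_l t1); apply: min_l; lra.
  apply/K'K/HK; last exact: K'y.
  have : 0 <= n1 * q j x by rewrite mulr_ge0 ?(ltW n1_gt0)// ltW//; exact: facet_q_gt0 xc.
  by move=> nq; apply/andP; split; lra.
- by move=> t x /andP[t0 t1] K'x; rewrite GK'//; apply: HK => //; rewrite t0.
- move=> x Kx; rewrite /G stretch_id; last first.
    move=> j; rewrite /nu (min_l ler01) mul0r; apply: min_r.
    by case: Kx => x0 _; rewrite mulr_ge0 ?q_ge0// ltW// n1_gt0.
  rewrite /late /= max_l; first by rewrite H0.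
  rewrite sub0r oppr_le0 mulr_ge0// sumr_ge0// => j _.
  by case: Kx => x0 _; rewrite mulr_ge0 ?q_ge0// ltW// n1_gt0.
- by move=> x K'x; rewrite GK'//; exact: H1.
Qed.

End AttachFacets.

(** * Combinatorics of the Whitehouse complex *)

Section Whitehouse.
Import mathcomp.boot.fintype mathcomp.boot.finset.
Local Open Scope nat_scope.
Local Open Scope set_scope.
Variable k : nat.
Notation leaf_type := 'I_k.+4.+1.
Implicit Types (S T U : {set leaf_type}) (C F s : {set {set leaf_type}}).

(** Here [n = k + 4]: there are [k + 3] leaves, vertices have between 2 and [k + 2] of them, and the
    facets to be attached have [k + 1] vertices. *)
Let K := @whitehouse_face k.+4.
Let a : leaf_type := inord 2.
Let leaves : {set leaf_type} := finset (fun i : leaf_type => 2 <= i).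
Let marked : {set {set leaf_type}} := finset (fun S => a \in S).

Definition compatible S T := [|| S \subset T, T \subset S | [disjoint S & T]].

Lemma wh_vertexE S :
  wh_vertex S = [&& S \subset leaves, 2 <= #|S| & #|S| <= k.+2].
Proof.
rewrite /wh_vertex !subSS subn0; congr (_ && _).
by apply/forall_inP/subsetP => SN i /SN; rewrite inE.
Qed.

Lemma whitehouse_faceP F :
  reflect ((forall S, S \in F -> wh_vertex S) /\
           (forall S T, S \in F -> T \in F -> compatible S T)) (K F).
Proof.
apply: (iffP andP) => -[FV FC]; split.
- by move=> S SF; exact: (forall_inP FV).
- by move=> S T SF; exact: (forall_inP (forall_inP FC S SF)).
- exact/forall_inP.
- by apply/forall_inP => S SF; apply/forall_inP => T TF; exact: FC.
Qed.

Lemma whitehouse_down_closed : down_closed K.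
Proof.
move=> F G /whitehouse_faceP[FV FC] /subsetP GF.
apply/whitehouse_faceP; split=> [S /GF|S T /GF SF /GF]; first exact: FV.
exact: FC.
Qed.

Lemma compatible_sym S T : compatible S T = compatible T S.
Proof. by rewrite /compatible orbCA disjoint_sym. Qed.

Lemma a_val : a = 2 :> nat. Proof. by rewrite inordK. Qed.

Lemma a_leaves : a \in leaves. Proof. by rewrite inE a_val. Qed.

Lemma card_leaves : #|leaves| = k.+3.
Proof.
have := cardsC leaves; rewrite card_ord.
suff -> : ~: leaves = [set ord0; inord 1].
  by rewrite cards2 -val_eqE /= inordK //; lia.
apply/setP => i; rewrite !inE -!val_eqE /= inordK //.
by case: i => -[|[|i]].
Qed.

(** The two added sets are not vertices, having sizes 1 and [k + 3]; they ensure that a missing size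
    always lies between two members. *)
Definition extend C : {set {set leaf_type}} := [set a] |: (leaves |: C).

(** * Sizes and gaps in a chain of marked vertices *)

Section Chain.
Variable C : {set {set leaf_type}}.
Hypotheses (KC : K C) (CA : C \subset marked).

Lemma extend_a S : S \in extend C -> a \in S.
Proof.
rewrite !inE => /or3P[/eqP->|/eqP->|SC]; [exact: set11 | exact: a_leaves|].
by have := subsetP CA _ SC; rewrite inE.
Qed.

Lemma chain_leaves S : S \in C -> S \subset leaves.
Proof.
by case/whitehouse_faceP: KC => CV _ /CV; rewrite wh_vertexE => /andP[].
Qed.

Lemma extend_leaves S : S \in extend C -> S \subset leaves.
Proof.
rewrite !inE => /or3P[/eqP->|/eqP->//|]; last exact: chain_leaves.
by rewrite sub1set a_leaves.
Qed.

Lemma chain_card S : S \in C -> 2 <= #|S| <= k.+2.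
Proof.
by case/whitehouse_faceP: KC => CV _ /CV; rewrite wh_vertexE => /andP[].
Qed.

(** Both members contain [a], which rules out disjointness. *)
Lemma extend_total S T : S \in extend C -> T \in extend C ->
  (S \subset T) || (T \subset S).
Proof.
move=> SC TC; have aS := extend_a SC; have aT := extend_a TC.
move: SC TC; rewrite !inE.
move=> /or3P[/eqP->|/eqP->|SC]; first by rewrite sub1set aT.
  by move=> TC; rewrite extend_leaves ?orbT// !inE.
move=> /or3P[/eqP->|/eqP->|TC]; first by rewrite sub1set aS orbT.
  by rewrite chain_leaves.
case/whitehouse_faceP: KC => _ /(_ S T SC TC) /or3P[->//|->|]; first by rewrite orbT.
by move/disjointFr => /(_ a aS); rewrite aT.
Qed.

Lemma extend_sub S T : S \in extend C -> T \in extend C -> #|S| <= #|T| ->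
  S \subset T.
Proof.
move=> SC TC ST; have /orP[//|TS] := extend_total SC TC.
have /eqP-> : T == S by rewrite eqEcard TS.
exact: subxx.
Qed.

Lemma chain_extend : C \subset extend C.
Proof. by apply/subsetP => S SC; rewrite !inE SC !orbT. Qed.

Lemma chain_card_inj : {in C &, injective (fun S => #|S|)}.
Proof.
move=> S T /(subsetP chain_extend) SC /(subsetP chain_extend) TC /= ST.
by apply/eqP; rewrite eqEcard extend_sub//= ST leqnn.
Qed.

(** Sizes are distinct along a chain, so [D] injects into a window of [len] sizes. *)
Lemma chain_size_bound (D : {set {set leaf_type}}) lo len : D \subset C ->
  (forall S, S \in D -> lo <= #|S| < lo + len) -> #|D| <= len.
Proof.
move=> /subsetP DC Dlo; rewrite -(size_iota lo len) cardE.
rewrite -(size_map (fun S => #|S|)); apply: uniq_leq_size.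
  rewrite map_inj_in_uniq ?enum_uniq// => S T; rewrite !mem_enum => /DC SC /DC TC.
  exact: chain_card_inj.
by move=> _ /mapP[S SD ->]; rewrite mem_iota; apply: Dlo; rewrite -mem_enum.
Qed.

Lemma card_chain : #|C| <= k.+1.
Proof.
apply: (@chain_size_bound C 2) => // S /chain_card.
by rewrite addSn ltnS addSn.
Qed.

Lemma chain_gap : #|C| < k.+1 ->
  exists2 t, 2 <= t <= k.+2 & forall S, S \in C -> #|S| != t.
Proof.
move=> Ck; pose sizes := [seq #|(X : {set leaf_type})| | X <- enum C].
have [/allP sz|/allPn[t]] := boolP (all (mem sizes) (iota 2 k.+1)).
  have := uniq_leq_size (iota_uniq 2 k.+1) sz.
  by rewrite size_iota size_map -cardE leqNgt Ck.
rewrite mem_iota => tk /negP nt; exists t; first by move: tk; rewrite !addSn ltnS.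
by move=> S SC; apply/negP => /eqP St; apply: nt; apply/mapP; exists S; rewrite ?mem_enum.
Qed.

(** The [k + 1] distinct sizes exhaust 2 to [k + 2]; the two added sets supply 1 and [k + 3]. *)
Lemma full_chain_size t : #|C| = k.+1 -> 1 <= t <= k.+3 ->
  exists2 S, S \in extend C & #|S| = t.
Proof.
move=> Ck /andP[t1 tk].
have [->|tn1] := eqVneq t 1.
  by exists [set a]; rewrite ?cards1// !inE eqxx.
have [->|tnk] := eqVneq t k.+3.
  by exists leaves; rewrite ?card_leaves// !inE eqxx orbT.
have sz : {subset [seq #|(X : {set leaf_type})| | X <- enum C] <= iota 2 k.+1}.
  move=> _ /mapP[S SC ->]; rewrite mem_iota.
  by have := @chain_card S; rewrite -mem_enum => /(_ SC); rewrite !addSn ltnS.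
have uz : uniq [seq #|(X : {set leaf_type})| | X <- enum C].
  rewrite map_inj_in_uniq ?enum_uniq// => S T; rewrite !mem_enum.
  exact: chain_card_inj.
have [|_ eqs] := uniq_min_size uz sz; first by rewrite size_iota size_map -cardE Ck.
have /mapP[S SC tS] : t \in [seq #|(X : {set leaf_type})| | X <- enum C].
  by rewrite eqs mem_iota; lia.
by exists S => //; apply: (subsetP chain_extend); rewrite -mem_enum.
Qed.

(* The vertex is the difference of two consecutive members of the extended
   chain that differ by at least two leaves. *)
Lemma cone_vertex : #|C| < k.+1 ->
  exists2 T, T \notin marked &
    forall s, K s -> s :&: marked = C -> K (T |: s).
Proof.
move=> Ck; have [t /andP[t2 tk] Ct] := chain_gap Ck.
have aC : [set a] \in extend C by rewrite !inE eqxx.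
have lC : leaves \in extend C by rewrite !inE eqxx orbT.
(* [A] is the last member below the missing size [t], and [B] the first above it. *)
have [A [AC At A_max]] : exists A, [/\ A \in extend C, #|A| < t &
    forall S, S \in extend C -> #|S| < t -> #|S| <= #|A|].
  case: (@arg_maxnP _ [set a] [pred S | (S \in extend C) && (#|S| < t)] (fun S => #|S|)).
    by rewrite /= aC cards1.
  by move=> A /andP[AC At] Am; exists A; split=> // S SC St; apply: Am; rewrite /= SC.
have [B [BC Bt B_min]] : exists B, [/\ B \in extend C, t < #|B| &
    forall S, S \in extend C -> t < #|S| -> #|B| <= #|S|].
  case: (@arg_minnP _ leaves [pred S | (S \in extend C) && (t < #|S|)] (fun S => #|S|)).
    by rewrite /= lC card_leaves.
  by move=> B /andP[BC Bt] Bm; exists B; split=> // S SC St; apply: Bm; rewrite /= SC.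
have AB : A \subset B by apply: extend_sub => //; lia.
have aA := extend_a AC.
have card_T : #|B :\: A| = #|B| - #|A| by rewrite cardsD (setIidPr AB).
exists (B :\: A); first by rewrite !inE aA.
move=> s Ks sC; case/whitehouse_faceP: (Ks) => sV sc.
(* [#|A| < t < #|B|] gives at least two leaves, and [a] in [A] leaves at most [k + 2]. *)
have TV : wh_vertex (B :\: A).
  rewrite wh_vertexE (subset_trans (subsetDl _ _) (extend_leaves BC)) card_T.
  have := subset_leq_card (extend_leaves BC); rewrite card_leaves.
  have : 0 < #|A| by rewrite card_gt0; apply/set0Pn; exists a.
  lia.
have compat_ext U S : U \in s -> a \notin U -> S \in extend C ->
    (U \subset S) || [disjoint U & S].
  move=> Us aU SC; have aS := extend_a SC; have Ul : U \subset leaves.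
    by have := sV U Us; rewrite wh_vertexE => /andP[].
  move: SC; rewrite !inE => /or3P[/eqP->|/eqP->|SC].
  - by rewrite orbC disjoint_sym disjoints1 aU.
  - by rewrite Ul.
  - have /or3P[->//|SU|->] : compatible U S; last by rewrite orbT.
      by apply: sc => //; move: SC; rewrite -sC inE => /andP[].
    by rewrite (subsetP SU _ aS) in aU.
(* A marked [U] does not have size [t], so it lies in [A] or contains [B]. An unmarked [U] lies in
   [A], lies in the difference, or misses [B]. *)
have compat_T U : U \in s -> compatible (B :\: A) U.
  move=> Us; rewrite /compatible; have [aU|aU] := boolP (a \in U).
    have UC : U \in C by rewrite -sC !inE Us.
    have UCe := subsetP chain_extend U UC.
    have := Ct U UC; rewrite neq_ltn => /orP[Ut|Ut].
      have UA : U \subset A by apply: extend_sub => //; exact: A_max.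
      rewrite [X in [|| _, _ | X]](_ : _ = true) ?orbT//.
      rewrite disjoint_sym disjoints_subset (subset_trans UA)//.
      by apply/subsetP => i iA; rewrite !inE iA.
    have BU : B \subset U by apply: extend_sub => //; exact: B_min.
    by rewrite (subset_trans (subsetDl _ _) BU).
  have /orP[UA|UA] := compat_ext U A Us aU AC.
    rewrite [X in [|| _, _ | X]](_ : _ = true) ?orbT//.
    rewrite disjoint_sym disjoints_subset (subset_trans UA)//.
    by apply/subsetP => i iA; rewrite !inE iA.
  have /orP[UB|UB] := compat_ext U B Us aU BC.
    by rewrite [X in [|| _, X | _]](_ : _ = true) ?orbT// subsetD UB.
  rewrite [X in [|| _, _ | X]](_ : _ = true) ?orbT//.
  by rewrite disjoint_sym; apply: disjointWr UB; exact: subsetDl.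
apply/whitehouse_faceP; split=> [S|S U].
  by rewrite !inE => /orP[/eqP->//|/sV].
rewrite !inE => /orP[/eqP->|Ss] /orP[/eqP->|Us].
- by rewrite /compatible subxx.
- exact: compat_T.
- by rewrite compatible_sym; exact: compat_T.
- exact: sc.
Qed.

End Chain.

(** * Faces whose marked part has no gap, and contractibility of the rest *)

Lemma marked_part s : K s -> K (s :&: marked) /\ s :&: marked \subset marked.
Proof.
move=> Ks; split; last exact: subsetIr.
exact: whitehouse_down_closed Ks (subsetIl _ _).
Qed.

(** An unmarked [U] in [s] would sit in a smallest member [S] of the extended chain, whose
    predecessor [T] has one leaf less. Minimality of [S] excludes [U] inside [T], the leaf [a]
    excludes [T] inside [U], and disjointness would leave [U] a single leaf. *)
Lemma full_chain_maximal C s : C \subset marked -> #|C| = k.+1 -> K s ->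
  C \subset s -> s = C.
Proof.
move=> CA Ck Ks Cs; have KC := whitehouse_down_closed Ks Cs.
case/whitehouse_faceP: (Ks) => sV sc.
have smC : C = s :&: marked.
  have [Km mm] := marked_part Ks.
  by apply/eqP; rewrite eqEcard subsetI Cs CA/= Ck card_chain.
apply/eqP; rewrite eqEsubset Cs andbT; apply/subsetP => U Us.
have [aU|aU] := boolP (a \in U); first by rewrite smC !inE Us.
have := sV U Us; rewrite wh_vertexE => /and3P[Ul U2 _].
have lC : leaves \in extend C by rewrite !inE eqxx orbT.
have [S [SC US S_min]] : exists S, [/\ S \in extend C, U \subset S &
    forall T, T \in extend C -> U \subset T -> #|S| <= #|T|].
  case: (@arg_minnP _ leaves [pred S | (S \in extend C) && (U \subset S)] (fun S => #|S|)).
    by rewrite /= lC Ul.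
  by move=> S /andP[SC US] Sm; exists S; split=> // T TC UT; apply: Sm; rewrite /= TC.
have US1 : U \proper S.
  by apply/properP; split => //; exists a => //; exact: extend_a CA _ SC.
have Ucard := proper_card US1.
have Sk : #|S| <= k.+3.
  by have := subset_leq_card (extend_leaves KC SC); rewrite card_leaves.
have [|T TC cT] := @full_chain_size C KC CA #|S|.-1 Ck.
  by move: Ucard U2 Sk; clear; case: #|S| => //; lia.
have aT := extend_a CA TC.
have TS : T \subset S by apply: (extend_sub KC CA) => //; rewrite cT leq_pred.
have S3 : 2 < #|S| := leq_ltn_trans U2 Ucard.
(* [T] is neither added set: its size is at least 2 and less than [k + 3]. *)
have TC' : T \in C.
  move: TC; rewrite !inE => /or3P[/eqP T1|/eqP Tl|//].
    by move: cT S3; rewrite T1 cards1; clear; lia.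
  by move: cT Sk; rewrite Tl card_leaves; clear; lia.
have /or3P[UT|TU|UT] := sc U T Us (subsetP Cs T TC').
- by move: (S_min T TC UT) S3; rewrite cT; clear; lia.
- by rewrite (subsetP TU _ aT) in aU.
- have : U \subset S :\: T by rewrite subsetD US.
  move/subset_leq_card; rewrite cardsD (setIidPr TS) cT.
  by move: U2; clear; lia.
Qed.

Definition combs : {set {set {set leaf_type}}} :=
  [set C | [&& K C, C \subset marked & #|C| == k.+1]].

Lemma combsP C : reflect [/\ K C, C \subset marked & #|C| = k.+1] (C \in combs).
Proof.
rewrite inE; apply: (iffP and3P) => -[KC CA Ck]; split => //; exact/eqP.
Qed.

(** A marked part with [k + 1] members is maximal, hence all of [s]. So being a comb depends only on
    the marked part, as [stratified_contractible] requires. *)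
Lemma noncombP s : K s ->
  (s \notin combs) = (#|s :&: marked| < k.+1).
Proof.
move=> Ks; have [Km mm] := marked_part Ks.
rewrite ltn_neqAle card_chain// andbT; congr negb; apply/combsP/eqP => [[_ sA sk]|mk].
  by rewrite (setIidPl sA).
have sm : s = s :&: marked by apply: full_chain_maximal => //; exact: subsetIl.
by rewrite sm.
Qed.

Lemma noncomb_contractible (R : realType) :
  @ambient_contractible R _ (fun s => K s && (s \notin combs)).
Proof.
pose P : {set {set {set leaf_type}}} :=
  [set C | [&& K C, C \subset marked & #|C| < k.+1]].
rewrite (_ : (fun s => _) = (fun s => K s && (s :&: marked \in P))); last first.
  apply/funext => s; have [Ks/=|//] := boolP (K s).
  by rewrite noncombP// inE; have [-> ->] := marked_part Ks.
have K0 : K set0.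
  by apply/whitehouse_faceP; split=> [S|S T]; rewrite inE.
apply: stratified_contractible.
- exact: whitehouse_down_closed.
- exact: K0.
- by rewrite inE K0 sub0set cards0.
- move=> C D; rewrite !inE => /and3P[KC CA Ck] DC; apply/and3P; split.
  + exact: whitehouse_down_closed KC DC.
  + exact: subset_trans DC CA.
  + exact: leq_ltn_trans (subset_leq_card DC) Ck.
- by move=> C; rewrite inE => /and3P[].
- by move=> C; rewrite inE => /and3P[KC CA Ck]; exact: cone_vertex.
Qed.


(** * Combs and orderings of the leaves other than [a] *)

Let leaf (i : 'I_k.+2) : leaf_type := rshift 3 i.

Lemma leaf_inj : injective leaf. Proof. exact: (@rshift_inj 3 k.+2). Qed.

Lemma leaf_neq_a i : leaf i != a.
Proof. by rewrite -val_eqE /= a_val. Qed.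

Lemma leavesP v : v \in leaves -> v = a \/ exists i, v = leaf i.
Proof.
rewrite inE => v2; have [va|va] := eqVneq v a; first by left.
have v3 : v - 3 < k.+2 by have := ltn_ord v; lia.
right; exists (Ordinal v3); apply: val_inj => /=.
by move: va; rewrite -val_eqE /= a_val; lia.
Qed.

Lemma leaf_ext S T : a \in S -> a \in T -> S \subset leaves -> T \subset leaves ->
  (forall i, (leaf i \in S) = (leaf i \in T)) -> S = T.
Proof.
move=> aS aT Sl Tl ST; apply/setP => v.
have [/leavesP[->|[i ->]]|vl] := boolP (v \in leaves); first by rewrite aS aT.
  exact: ST.
have nv (U : {set leaf_type}) : U \subset leaves -> v \in U = false.
  by move=> Ul; apply: contraNF vl; exact: subsetP.
by rewrite !nv.
Qed.

(** [p i] is the position of [leaf i] in the ordering, counted from 0. *)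
Definition initial (p : 'S_k.+2) (j : nat) : {set leaf_type} :=
  a |: (leaf @: [set i | p i < j]).

(** The shift [j.+1] leaves out [[set a]], and the range of [j] stops before all the leaves: neither
    is a vertex. *)
Definition comb (p : 'S_k.+2) : {set {set leaf_type}} :=
  [set initial p j.+1 | j : 'I_k.+1].

Lemma leaf_initial p j i : (leaf i \in initial p j) = (p i < j).
Proof.
by rewrite in_setU1 (negPf (leaf_neq_a i)) (mem_imset _ _ leaf_inj) inE.
Qed.

Lemma a_initial p j : a \in initial p j.
Proof. by rewrite in_setU1 eqxx. Qed.

Lemma initial_leaves p j : initial p j \subset leaves.
Proof.
rewrite subUset sub1set a_leaves /=; apply/subsetP => _ /imsetP[i _ ->].
by rewrite inE.
Qed.

Lemma card_initial p j : j <= k.+2 -> #|initial p j| = j.+1.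
Proof.
move=> jk; rewrite cardsU1 (_ : (_ \notin _) = true); last first.
  by apply/imsetP => -[i _] /esym/eqP; rewrite (negPf (leaf_neq_a i)).
rewrite card_imset; last exact: leaf_inj.
rewrite (_ : [set i | p i < j] = p @^-1: [set i : 'I_k.+2 | i < j]); last first.
  by apply/setP => i; rewrite !inE.
rewrite card_preimset; last exact: perm_inj.
by rewrite -sum1dep_card (big_ord_narrow jk) sum1_card card_ord.
Qed.

Lemma sub_initial p i j : i <= j -> initial p i \subset initial p j.
Proof.
move=> ij; apply/setUS/imsetS/subsetP => x; rewrite !inE => /leq_trans; exact.
Qed.

Lemma comb_combs p : comb p \in combs.
Proof.
apply/combsP; split.
- apply/whitehouse_faceP; split=> [_ /imsetP[j _ ->]|_ _ /imsetP[i _ ->] /imsetP[j _ ->]].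
    rewrite wh_vertexE initial_leaves card_initial; last by have := ltn_ord j; lia.
    by have := ltn_ord j; lia.
  rewrite /compatible; have [ij|/ltnW ij] := leqP i j; first by rewrite sub_initial.
  by rewrite [X in _ || (X || _)]sub_initial ?orbT.
- by apply/subsetP => _ /imsetP[j _ ->]; rewrite inE a_initial.
- rewrite card_imset ?card_ord// => i j /(congr1 (fun S : {set leaf_type} => #|S|)).
  have := ltn_ord i; have := ltn_ord j => jk ik.
  by rewrite !card_initial; [move=> [/val_inj] | lia | lia].
Qed.

(** Members of equal size coincide, so the comb determines the truth of [p i < j.+1] for each
    [j < k.+1]; these thresholds determine [p i]. *)
Lemma comb_inj : injective comb.
Proof.
move=> p r pr; have lt_eq i j : j < k.+1 -> (p i < j.+1) = (r i < j.+1).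
  move=> jk; have : initial p (Ordinal jk).+1 \in comb r by rewrite -pr; apply/imsetP; exists (Ordinal jk).
  case/imsetP => j' _ /= jj'; have := ltn_ord j' => j'k.
  have := congr1 (fun S : {set leaf_type} => #|S|) jj'; rewrite /= !card_initial; try lia.
  by move=> [jE]; rewrite -!leaf_initial jj' jE.
apply/permP => i; apply: val_inj => /=.
have := ltn_ord (p i); have := ltn_ord (r i) => rk pk.
have [pr_lt|rp_lt|//] := ltngtP (p i) (r i).
  have := lt_eq i (r i).-1; rewrite (ltn_predK pr_lt) pr_lt ltnn.
  by move=> /(_ ltac:(lia)).
have := lt_eq i (p i).-1; rewrite (ltn_predK rp_lt) rp_lt ltnn.
by move=> /(_ ltac:(lia)).
Qed.

Section Rank.
Variable F : {set {set leaf_type}}.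
Hypothesis Fcomb : F \in combs.

Let KF : K F. Proof. by case/combsP: Fcomb. Qed.
Let FA : F \subset marked. Proof. by case/combsP: Fcomb. Qed.
Let Fk : #|F| = k.+1. Proof. by case/combsP: Fcomb. Qed.

(** Once a leaf enters the chain it stays, so the number of members avoiding it is its position in
    the ordering. *)
Definition avoiding i := [set S in F | leaf i \notin S].

Lemma avoiding_lt i : #|avoiding i| < k.+2.
Proof.
have : #|avoiding i| <= #|F|.
  by apply/subset_leq_card/subsetP => S; rewrite inE => /andP[].
by rewrite Fk.
Qed.

Definition rank i : 'I_k.+2 := Ordinal (avoiding_lt i).

(** If [leaf i] is in [S], the members avoiding it have sizes 2 to [#|S| - 1]. Otherwise the members
    containing it have sizes [#|S| + 1] to [k + 2]. Counting sizes bounds the rank from above or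
    from below. *)
Lemma leaf_rank i S : S \in extend F -> (leaf i \in S) = (rank i < #|S|.-1).
Proof.
move=> SF /=; have aS := extend_a FA SF.
have S1 : 0 < #|S| by rewrite card_gt0; apply/set0Pn; exists a.
have FF T : T \in F -> T \in extend F by apply/subsetP/chain_extend.
have sub_avoid : avoiding i \subset F by apply/subsetP => T; rewrite inE => /andP[].
have [iS|iS] := boolP (leaf i \in S).
  have S2 : 1 < #|S|.
    have <- : #|[set a; leaf i]| = 2 by rewrite cards2 eq_sym leaf_neq_a.
    by apply: subset_leq_card; rewrite subUset !sub1set aS.
  suff av : #|avoiding i| <= #|S| - 2.
    by apply/esym/(leq_ltn_trans av); move: S2; clear; case: #|S| => [|[|m]] // _; lia.
  apply: (@chain_size_bound F KF FA _ 2) => // T; rewrite inE => /andP[TF iT].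
  have /andP[-> _] := chain_card KF TF.
  rewrite subnKC// ltnNge; apply: contra iT => ST.
  exact: (subsetP (extend_sub KF FA SF (FF _ TF) ST)).
have Sk : #|S| <= k.+2.
  have : S \subset leaves :\ leaf i.
    by rewrite subsetD1 (extend_leaves KF SF).
  have := cardsD1 (leaf i) leaves; rewrite card_leaves.
  have -> : leaf i \in leaves by rewrite inE.
  by rewrite add1n => -[lk] /subset_leq_card; rewrite -lk.
have : #|F :\: avoiding i| <= k.+3 - #|S|.+1.
  apply: (@chain_size_bound F KF FA _ #|S|.+1); first exact: subsetDl.
  move=> T; rewrite !inE negb_and negbK => /andP[iT TF].
  have /andP[_ Tk] := chain_card KF TF.
  rewrite subnKC// ltnS Tk andbT ltnNge.
  rewrite TF /= in iT; apply: contra iS => TS.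
  exact: (subsetP (extend_sub KF FA (FF _ TF) SF TS)).
rewrite cardsD (setIidPr sub_avoid) Fk => le.
by apply/esym/negbTE; move: le Sk S1; rewrite -leqNgt; move: #|avoiding i| #|S| => x y; clear; lia.
Qed.

(** The members of sizes [r + 1] and [r + 2] differ by a single leaf, and every leaf of rank [r]
    lies in that difference. *)
Lemma rank_inj : injective rank.
Proof.
move=> i i' ii'; have rk := ltn_ord (rank i).
have [|S SF cS] := @full_chain_size F KF FA (rank i).+2 Fk; first by move: rk; clear; lia.
have [|T TF cT] := @full_chain_size F KF FA (rank i).+1 Fk; first by move: rk; clear; lia.
have TS : T \subset S by apply: (extend_sub KF FA) => //; rewrite cS cT.
have /cards1P[x xE] : #|S :\: T| == 1 by rewrite cardsD (setIidPr TS) cS cT subSnn.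
have inST i1 : rank i1 = rank i -> leaf i1 = x.
  move=> i1i; apply/set1P; rewrite -xE inE !leaf_rank// i1i cS cT /=.
  by rewrite ltnn ltnSn.
by apply: leaf_inj; rewrite !inST.
Qed.

Lemma comb_rank : comb (perm rank_inj) = F.
Proof.
apply/esym/eqP; rewrite eqEcard; apply/andP; split; last first.
  by have /combsP[_ _ ->] := comb_combs (perm rank_inj); rewrite Fk.
apply/subsetP => S SF; have SFe := subsetP (chain_extend F) S SF.
have /andP[S2 Sk] := chain_card KF SF.
have jk : #|S| - 2 < k.+1 by move: S2 Sk; clear; lia.
(* [initial p j.+1] has [j + 2] elements, hence the index [#|S| - 2]. *)
apply/imsetP; exists (Ordinal jk) => //=.
apply: leaf_ext.
- exact: extend_a SFe.
- exact: a_initial.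
- exact: chain_leaves SF.
- exact: initial_leaves.
move=> i; rewrite leaf_initial permE leaf_rank//; congr (_ < _).
by move: S2; clear; case: #|S| => [|[|m]] // _; lia.
Qed.

End Rank.

Lemma card_combs : #|combs| = (k.+2)`!.
Proof.
rewrite -card_Sn -(card_imset _ comb_inj); congr #|pred_of_set _|.
apply/setP => F; apply/idP/imsetP => [Fc|[p _ ->]]; last exact: comb_combs.
by exists (perm (@rank_inj F Fc)) => //; rewrite comb_rank.
Qed.

End Whitehouse.

(** * The case [n = 3] and the conclusion *)

Lemma whitehouse_face3 (F : {set {set 'I_4}}) : @whitehouse_face 3 F -> F = finset.set0.
Proof.
move=> /andP[/forall_inP FV _]; apply/setP => S; rewrite finset.in_set0.
by apply/negP => /FV /and3P[_ S2]; rewrite leqNgt S2.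
Qed.

Lemma homotopy_equivalent_set0 (R : realType) (I J : Type) :
  @homotopy_equivalent R {ptws I -> R} {ptws J -> R} set0 set0.
Proof.
exists (fun=> fun=> 0), (fun=> fun=> 0); split => //.
- exact: continuous_subspace0.
- exact: continuous_subspace0.
- by exists snd; split => //; rewrite setX0; exact: continuous_subspace0.
- by exists snd; split => //; rewrite setX0; exact: continuous_subspace0.
Qed.

Theorem mainTheorem12 (R : realType) (n : nat) : (3 <= n)%N ->
  @homotopy_equivalent R
    {ptws {set 'I_n.+1} -> R} {ptws ('I_(n - 3).-1 + 'I_(n - 2)`!)%type -> R}
    (@realization R _ (@whitehouse_face n))
    (@wedge_of_spheres R (n - 2)`! (n - 3)).
Proof.
case: n => [|[|[|[|k]]]] // _.
  (* A point supported on the only face, the empty one, would have total mass 0 instead of 1. *)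
  have K0 : @realization R _ (@whitehouse_face 3) = set0.
    apply/seteqP; split=> // x [_ [x1 /whitehouse_face3 x0]].
    suff : \sum_v x v = 0 by rewrite x1 => /eqP; rewrite oner_eq0.
    apply: big1 => v _; apply/eqP.
    by have := finset.in_set0 v; rewrite -x0 inE => /negbFE.
  by rewrite K0; exact: homotopy_equivalent_set0.
have combE := card_combs k.
(* An enumeration of the combs, indexed by the spheres of the wedge. *)
pose c (j : 'I_((k.+4 - 2)`!)) : {set {set 'I_k.+4.+1}} :=
  enum_val (cast_ord (esym combE) j).
have c_comb j : c j \in combs k by exact: enum_valP.
have c_codom s : (s \in codom c) = (s \in combs k).
  apply/codomP/idP => [[j ->//]|sc].
  exists (cast_ord combE (enum_rank_in sc s)).
  by rewrite /c cast_ordK enum_rankK_in.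
apply: (@wedge_homotopy_equivalent R _ (@whitehouse_face k.+4) k _ c).
- exact: whitehouse_down_closed.
- by move=> i j /enum_val_inj/cast_ord_inj.
- by move=> j; have /combsP[] := c_comb j.
- by move=> j; have /combsP[] := c_comb j.
- by move=> j s Ks; have /combsP[_ ? ?] := c_comb j; exact: full_chain_maximal.
rewrite (_ : (fun s => _) = (fun s => whitehouse_face s && (s \notin combs k))).
  exact: noncomb_contractible.
by apply/funext => s; rewrite c_codom.
Qed.
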